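(* Let $k$ be an even positive integer, and let $n,j$ be integers with $2\leq j\leq\frac{n}{2}$. Then $C_n^{\{0,j\}}$ can be embedded in $K_k^*$ if and only if $k\geq4$, $n\leq\frac{k^2}{2}$, and $(k,n,j)\neq(4,8,2)$.
   Context: $K_k^*$ denotes the complete graph $K_k$ on vertices $v_0,\dotsc,v_{k-1}$ with a loop $v_iv_i$ added at every vertex. An embedding of a graph $G$ in $K_k^*$ is a map $f:V(G)\to V(K_k^* )$ such that each edge $uv$ of $G$ is sent to the edge $f(u)f(v)$ of $K_k^*$ (a loop if $f(u)=f(v)$), and the induced map $E(G)\to E(K_k^* )$ is injective. For $2\leq j\leq n/2$, $C_n^{\{0,j\}}$ is the cycle $w_0w_1\dotsb w_{n-1}w_0$ on $n$ vertices together with one chord $w_0w_j$. *)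

(* Defs.v *)
From mathcomp Require Import all_boot.

Set Implicit Arguments.
Unset Strict Implicit.
Unset Printing Implicit Defensive.

(* A graph, possibly with loops, is a symmetric adjacency relation on a finite
   vertex type. The edge uv is the set [set u; v], so that a loop uu is the
   singleton [set u] and uv = vu. *)
Definition edges (V : finType) (adj : rel V) : {set {set V}} :=
  [set A | [exists u, exists v, adj u v && (A == [set u; v])]].

(* f @: [set u; v] = [set f u; f v], so fun A => f @: A is the map induced by f
   on edges. *)
Definition embedding (V W : finType) (adjG : rel V) (adjH : rel W)
    (f : V -> W) : Prop :=
  (forall u v : V, adjG u v -> adjH (f u) (f v)) /\
  {in edges adjG &, injective (fun A : {set V} => f @: A)}.

Definition embeddable (V W : finType) (adjG : rel V) (adjH : rel W) : Prop :=
  exists f : V -> W, embedding adjG adjH f.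

(* K_k^*: any two vertices, equal or not, are adjacent. *)
Definition complete_looped (k : nat) : rel 'I_k := fun _ _ => true.

Definition cycle_adj (n : nat) : rel 'I_n :=
  fun a b => (val b == a.+1 %% n) || (val a == b.+1 %% n).

Definition chord_adj (n j : nat) : rel 'I_n :=
  fun a b => ((val a == 0) && (val b == j)) || ((val b == 0) && (val a == j)).

(* C_n^{0,j}; it is meant for 2 <= j <= n / 2, hence n >= 4. *)
Definition chorded_cycle (n j : nat) : rel 'I_n :=
  fun a b => cycle_adj a b || chord_adj j a b.

Lemma chorded_cycle_sym (n j : nat) : symmetric (@chorded_cycle n j).
Proof.
by move=> a b; rewrite /chorded_cycle /cycle_adj /chord_adj;
  congr (_ || _); rewrite orbC.
Qed.

Lemma chorded_cycle_irr (n j : nat) :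
  2 <= j -> 2 * j <= n -> irreflexive (@chorded_cycle n j).
Proof.
move=> j2 jn a; have n4 : 4 <= n by apply: leq_trans jn; rewrite (leq_mul2l 2 2).
rewrite /chorded_cycle /cycle_adj /chord_adj !orbb; apply/norP; split.
  have := ltn_ord a; rewrite leq_eqVlt => /orP[/eqP an|an].
    by rewrite an modnn -lt0n -ltnS an; apply: leq_trans n4.
  by rewrite modn_small // neq_ltn ltnSn.
by apply/andP => -[/eqP -> /eqP j0]; rewrite -j0 in j2.
Qed.

(* Main.v *)
Require Import Defs.
From mathcomp Require Import all_boot zify.

Set Implicit Arguments.
Unset Strict Implicit.
Unset Printing Implicit Defensive.

(* Necessity. A vertex [v] of K_k^* has [k + 1] edge-ends (its loop counts
   twice) and each visit of the cycle to [v] uses two of them. As [k] is even,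
   the cycle visits [v] at most [k / 2] times, hence [n <= k * (k / 2)].

   Sufficiency. It suffices to find, for [p, q >= 2] and [2 * (p + q) <= k ^ 2],
   two walks of lengths [p] and [q] joining the same two vertices which, together
   with the edge between these vertices, repeat no edge. For [k = 4] and [k = 6]
   explicit walks are given. To pass from [k] to [k + 2], lengthen the longer
   walk by a closed walk a x v1 y v2 x v3 y ... a through the new vertices [x]
   and [y], whose loops may be added: this increases the length by [4 * i + e]
   for any [1 <= i <= k / 2] and [e <= 2]. *)

(** * Theta graphs traced by closed walks *)

Definition edge (u v : nat) : nat * nat := (minn u v, maxn u v).

Lemma edgeC u v : edge u v = edge v u.
Proof. by rewrite /edge minnC maxnC. Qed.

(* [a :: s ++ t] is a closed walk; with the chord from [a] to [last a s] it
   traces the theta graph whose long paths have lengths [p] and [q]. *)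
Definition theta (k p q : nat) : Prop :=
  exists a s t, [/\ size s = p, size t = q, all (gtn k) (a :: s ++ t),
    last a (s ++ t) = a
    & uniq (edge a (last a s) :: pairmap edge a (s ++ t))].

(** Start the closed walk at the other end of the chord. *)
Lemma thetaC k p q : theta k p q -> theta k q p.
Proof.
move=> [a [s [t [sp tq wk]]]]; rewrite last_cat => cl un.
exists (last a s), t, s; split=> //.
- move: wk; rewrite -cat_cons all_cat => /andP[ask tk] /=.
  rewrite all_cat tk; have /= -> := allP ask _ (mem_last a s).
  by case/andP: ask.
- by rewrite last_cat cl.
move: un; rewrite cl edgeC !pairmap_cat cl /=.
by rewrite !mem_cat orbC uniq_catC.
Qed.

Lemma theta_leq k l p q : k <= l -> theta k p q -> theta l p q.
Proof.
move=> kl [a [s [t [sp tq wk cl un]]]]; exists a, s, t; split=> //.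
by apply: sub_all wk => x /= xk; apply: leq_trans kl.
Qed.

(** * The cases k = 4 and k = 6, by computation *)

Fixpoint del_loop (x : nat) (s : seq nat) : seq nat :=
  if s is y :: s' then if y == x then s' else y :: del_loop y s' else [::].

Definition theta_check (k p q : nat) (w : seq nat * seq nat) : bool :=
  let: (s, t) := w in
  [&& size s == p, size t == q, all (gtn k) (0 :: s ++ t), last 0 (s ++ t) == 0
    & uniq (edge 0 (last 0 s) :: pairmap edge 0 (s ++ t))].

(** Deleting loops keeps the ends of a walk, so [t] still starts at [last 0 s]. A walk with too few
    loops stays too long and fails [theta_check]. *)
Definition shorten (p q : nat) (w : seq nat * seq nat) : seq nat * seq nat :=
  let: (s, t) := w in
  (iter (size s - p) (del_loop 0) s, iter (size t - q) (del_loop (last 0 s)) t).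

Definition theta_in (k : nat) (ws : seq (seq nat * seq nat)) (p q : nat) :=
  has (fun w => theta_check k p q (shorten p q w)) ws.

Lemma theta_inP k ws p q : theta_in k ws p q -> theta k p q.
Proof.
case/hasP=> w _; case: (shorten p q w) => s t /and5P[/eqP sp /eqP tq wk /eqP cl un].
by exists 0, s, t.
Qed.

(* Found by computer search: deleting loops from these walks yields all pairs of
   lengths that are needed; those missing from [walks6] come from [walks4]. *)
Definition walks4 : seq (seq nat * seq nat) :=
  [:: ([:: 2; 2; 1], [:: 1; 3; 3; 0; 0]);
      ([:: 3; 3; 1; 1], [:: 2; 2; 0; 0])].

Definition walks6 : seq (seq nat * seq nat) :=
  [:: ([:: 0; 3; 4; 4; 1; 1], [:: 5; 2; 2; 0; 4; 2; 1; 3; 3; 5; 5; 0]);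
      ([:: 0; 2; 2; 1], [:: 1; 3; 2; 5; 0; 3; 3; 4; 1; 5; 5; 4; 4; 0]);
      ([:: 4; 1; 2; 3; 3; 0; 5; 1; 1], [:: 3; 5; 5; 4; 4; 2; 2; 0; 0]);
      ([:: 5; 1; 3; 5; 5; 4; 4; 1], [:: 1; 2; 2; 4; 0; 3; 3; 2; 0; 0]);
      ([:: 3; 3; 2; 4; 1], [:: 1; 2; 2; 0; 0; 5; 5; 1; 3; 5; 4; 4; 0]);
      ([:: 3; 3; 1], [:: 2; 2; 3; 5; 1; 1; 4; 4; 5; 5; 0; 2; 4; 0; 0]);
      ([:: 0; 4; 4; 1], [:: 2; 5; 5; 3; 3; 2; 0]);
      ([:: 2; 2; 5; 4; 1], [:: 5; 5; 0; 3; 4; 0]);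
      ([:: 5; 5; 1], [:: 1; 3; 4; 2; 1; 4; 0; 0]);
      ([:: 4; 1], [:: 5; 2; 1; 1; 3; 2; 2; 0; 3; 3; 4; 4; 5; 5; 0; 0]);
      ([:: 3; 1; 1; 5; 4; 4; 1], [:: 2; 4; 0; 2; 2; 3; 3; 5; 5; 0; 0]);
      ([:: 2; 1], [:: 1; 5; 2; 3; 0; 0; 5; 4; 0])].

Lemma walks4_complete :
  all (fun p => all (fun q => (p + q <= 8) && ((p, q) != (2, 6)) ==>
    theta_in 4 walks4 p q) (iota p 9)) (iota 2 3).
Proof. by vm_compute. Qed.

(** From [2 <= p <= q] and [p + q <= 18] follow [p <= 9] and [q - p <= 14], so the ranges cover all
    such pairs. The pair (2, 6), excluded for k = 4, is recovered here. *)
Lemma walks6_complete :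
  all (fun p => all (fun q => (p + q <= 18) && ((8 < p + q) || ((p, q) == (2, 6)))
    ==> theta_in 6 walks6 p q) (iota p 15)) (iota 2 8).
Proof. by vm_compute. Qed.

Lemma theta4 p q : 2 <= p <= q -> p + q <= 8 -> (p, q) != (2, 6) -> theta 4 p q.
Proof.
move=> /andP[p2 pq] pq8 ne; apply: (@theta_inP _ walks4).
have /allP/(_ p) H := walks4_complete.
have /allP/(_ q) : all (fun q => (p + q <= 8) && ((p, q) != (2, 6)) ==>
    theta_in 4 walks4 p q) (iota p 9) by apply: H; rewrite mem_iota; lia.
by rewrite pq8 ne; apply; rewrite mem_iota; lia.
Qed.

Lemma theta6 p q : 2 <= p <= q -> p + q <= 18 -> theta 6 p q.
Proof.
move=> /andP[p2 pq] pq18.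
case: (boolP ((8 < p + q) || ((p, q) == (2, 6)))) => [C|]; last first.
  rewrite negb_or -leqNgt => /andP[pq8 ne].
  by apply: (@theta_leq 4) => //; apply: theta4; rewrite ?p2.
apply: (@theta_inP _ walks6).
have /allP/(_ p) H := walks6_complete.
have /allP/(_ q) : all (fun q => (p + q <= 18) && ((8 < p + q) || ((p, q) == (2, 6)))
    ==> theta_in 6 walks6 p q) (iota p 15) by apply: H; rewrite mem_iota; lia.
by rewrite pq18 C; apply; rewrite mem_iota; lia.
Qed.

(** * Passing from k to k + 2 *)

Fixpoint weave (x y : nat) (s : seq nat) : seq nat :=
  if s is u :: s' then x :: u :: weave y x s' else [::].

Lemma size_weave x y s : size (weave x y s) = (size s).*2.
Proof. by elim: s x y => //= u s IH x y; rewrite IH doubleS. Qed.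

Lemma last_weave a x y s : last a (weave x y s) = last a s.
Proof. by elim: s a x y => //= u s IH a x y; rewrite IH. Qed.

Lemma all_weave (P : pred nat) x y s :
  P x -> P y -> all P s -> all P (weave x y s).
Proof.
move=> Px Py; elim: s x y Px Py => //= u s IH x y Px Py /andP[Pu Ps].
by rewrite Px Pu IH.
Qed.

Lemma edges_weave a x y s : ~~ odd (size s) ->
  perm_eq (pairmap edge a (weave x y s))
    ([seq edge u x | u <- belast a s] ++ [seq edge u y | u <- s]).
Proof.
(* Peeling off two entries at a time restores the roles of [x] and [y]. *)
elim: {s}(size s) {-2}s (leqnn (size s)) a => [|m IH] [|u [|v s]] //= sm a ev.
apply/permP=> P; have /permP/(_ P) := IH s (ltnW sm) v (negbNE ev).
by rewrite /= !count_cat /= (edgeC x u) (edgeC y v); lia.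
Qed.

Definition detour (x y : nat) (lx ly : bool) (s : seq nat) : seq nat :=
  if s is u :: v :: s' then
    x :: nseq lx x ++ u :: y :: nseq ly y ++ v :: weave x y s'
  else [::].

(** As the walk is closed, [belast a s] is a rearrangement of [s], so [x] and [y] are joined to the
    same old vertices. *)
Lemma edges_detour a x y lx ly s :
  ~~ odd (size s) -> 0 < size s -> uniq s -> last a s = a ->
  perm_eq (pairmap edge a (detour x y lx ly s))
    (nseq lx (edge x x) ++ nseq ly (edge y y) ++
      [seq edge u x | u <- s] ++ [seq edge u y | u <- s]).
Proof.
move=> ev s0 us la; apply: (@perm_trans _ (nseq lx (edge x x) ++
  nseq ly (edge y y) ++ pairmap edge a (weave x y s))).
  case: s ev s0 us la => [|u [|v s]] //= _ _ _ _.
  by apply/permP=> P; case: lx; case: ly; rewrite /= ?count_cat /=; lia.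
rewrite !perm_cat2l; apply: perm_trans (edges_weave a x y ev) _.
rewrite perm_cat2r; apply: perm_map; rewrite -(perm_cons a).
by rewrite [a :: s]lastI la perm_sym perm_rcons.
Qed.

Lemma all_pairmap_edge k a s :
  all (gtn k) (a :: s) -> all (fun e => e.2 < k) (pairmap edge a s).
Proof.
elim: s a => //= u s IH a /and3P[ak uk sk].
by rewrite gtn_max ak uk /= IH //= uk.
Qed.

(** The second component of an edge is its larger end, so the second claim says that every edge
    meets a new vertex. This separates the detour from any walk on old vertices. *)
Lemma uniq_detour k a lx ly s :
  ~~ odd (size s) -> 0 < size s -> uniq s -> last a s = a -> all (gtn k) s ->
  uniq (pairmap edge a (detour k k.+1 lx ly s)) /\
  all (fun e => k <= e.2) (pairmap edge a (detour k k.+1 lx ly s)).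
Proof.
move=> ev s0 us la sk; have P := edges_detour k k.+1 lx ly ev s0 us la.
have E x : k <= x -> [seq edge u x | u <- s] = [seq (u, x) | u <- s].
  move=> kx; apply/eq_in_map=> u /(allP sk)/= uk.
  by rewrite /edge; congr (_, _); lia.
rewrite (perm_uniq P) (perm_all _ P) !E // {P E}; split; last first.
  rewrite !all_cat !all_nseq !all_map /edge /= !maxnn leqnn leqnSn !orbT /=.
  by apply/andP; split; apply/allP=> u _ /=.
have N x y : k <= x -> (edge x x \in [seq (u, y) | u <- s]) = false.
  move=> kx; apply/mapP=> -[u /(allP sk)/= uk [e _]].
  by move: e; rewrite minnn => e; lia.
rewrite !cat_uniq !has_cat !map_inj_uniq ?us /=; try by move=> ? ? [].
have H : ~~ has (mem [seq (u, k) | u <- s]) [seq (u, k.+1) | u <- s].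
  by apply/hasPn=> e /mapP[u _ ->]; apply/mapP=> -[v _ [_]]; lia.
rewrite H.
have G b x y : k <= x -> has (mem (nseq b (edge x x))) [seq (u, y) | u <- s] = false.
  move=> kx; apply/hasP=> -[e eS /=]; rewrite mem_nseq => /andP[_ /eqP ee].
  by move: eS; rewrite ee N.
rewrite !G //=.
case: lx; case: ly => //=; rewrite ?inE /= ?orbF ?andbT //.
by apply/eqP=> -[]; lia.
Qed.

Lemma size_detour x y lx ly s : ~~ odd (size s) -> 0 < size s ->
  size (detour x y lx ly s) = (size s).*2 + lx + ly.
Proof.
case: s => [|u [|v s]] //= _ _.
by case: lx; case: ly; rewrite /= size_weave; lia.
Qed.

Lemma last_detour a x y lx ly s : ~~ odd (size s) ->
  last a (detour x y lx ly s) = last a s.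
Proof.
case: s => [|u [|v s]] //= _.
by case: lx; case: ly; rewrite /= last_weave.
Qed.

Lemma all_detour (P : pred nat) x y lx ly s : ~~ odd (size s) ->
  P x -> P y -> all P s -> all P (detour x y lx ly s).
Proof.
case: s => [|u [|v s]] //= _ Px Py /and3P[Pu Pv Ps].
by case: lx; case: ly; rewrite /= ?Px ?Py Pu Pv all_weave.
Qed.

(* The detour from [a] through two new vertices uses [2 * i] old vertices,
   including [a], and [e] of the two new loops. *)
Lemma theta_detour k p q i e :
  0 < i -> i.*2 <= k -> e <= 2 -> theta k p q -> theta k.+2 p (q + (4 * i + e)).
Proof.
move=> i0 ik e2 [a [s [t [sp tq wk cl un]]]].
have ak : a < k by case/andP: wk.
(* One fewer than [2 * i], since [a] is appended to close the detour. *)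
pose r := take (i.*2).-1 (rem a (iota 0 k)).
have aI : a \in iota 0 k by rewrite mem_iota.
have rsub u : u \in r -> u != a /\ u < k.
  by move=> /mem_take; rewrite mem_rem_uniq ?iota_uniq // !inE mem_iota => /andP[].
have sr : size r = (i.*2).-1.
  by rewrite size_takel // size_rem // size_iota; lia.
pose v := rcons r a.
have sv : size v = i.*2 by rewrite size_rcons sr; lia.
have uv : uniq v.
  rewrite rcons_uniq take_uniq ?rem_uniq ?iota_uniq // andbT.
  by apply/negP=> /rsub[]; rewrite eqxx.
have vk : all (gtn k) v.
  by rewrite all_rcons /= ak; apply/allP=> u /rsub[].
have lv : last a v = a by rewrite last_rcons.
have ev : ~~ odd (size v) by rewrite sv odd_double.
have v0 : 0 < size v by rewrite sv double_gt0.
(* As [e <= 2], the two booleans add up to [e]. *)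
pose c := detour k k.+1 (0 < e) (1 < e) v.
have [uc kc] := uniq_detour (0 < e) (1 < e) ev v0 uv lv vk.
have sc : size c = 4 * i + e by rewrite size_detour // sv {tq wk un uc kc}; lia.
have lc : last a c = a by rewrite last_detour.
have ck : all (gtn k.+2) c.
  by apply: all_detour => //=; apply: sub_all vk => z /= zk; do 2!apply: leqW.
exists a, s, (t ++ c); split=> //.
- by rewrite size_cat tq sc.
- rewrite catA -cat_cons all_cat ck andbT.
  by apply: sub_all wk => z /= zk; do 2!apply: leqW.
- by rewrite catA last_cat cl lc.
rewrite catA pairmap_cat cl -cat_cons cat_uniq un uc andbT /=.
apply/hasPn=> x xc; apply/negP=> xs.
have /allP/(_ _ xs) : all (fun e => e.2 < k)
    (edge a (last a s) :: pairmap edge a (s ++ t)).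
  rewrite /= all_pairmap_edge // andbT gtn_max ak /=.
  by apply: (allP wk); rewrite -cat_cons mem_cat mem_last.
by rewrite ltnNge (allP kc _ xc).
Qed.

Lemma theta_even h p q :
  3 <= h -> 2 <= p -> 2 <= q -> p + q <= 2 * h ^ 2 -> theta h.*2 p q.
Proof.
elim: h p q => [|h IH] // p q.
rewrite ltnS leq_eqVlt => /predU1P[<-|h3] p2 q2 pq.
  case: (leqP p q) => c; last apply: thetaC.
    by apply: theta6; rewrite ?p2.
  by apply: theta6; [rewrite q2 ltnW | rewrite addnC].
wlog le_pq : p q p2 q2 pq / p <= q.
  move=> W; case: (leqP p q) => c; first exact: W.
  by apply: thetaC; apply: W => //; [rewrite addnC | exact: ltnW].
rewrite doubleS; case: (leqP (p + q) (2 * h ^ 2)) => c.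
  by apply: (@theta_leq h.*2); [lia | apply: IH].
pose d := p + q - 2 * h ^ 2.
(* Since [q] is at least [h ^ 2 + d / 2], this keeps the shortened [q] at least 2. *)
have hh : 3 * h <= h ^ 2 by rewrite leq_mul2r h3 orbT.
have dh : d <= 4 * h + 2 by rewrite /d; move: pq; rewrite !expnS !expn0; nia.
have [d4|d4] := leqP d (4 * h).
(* Rounding [d] up to a multiple of 4 avoids the new loops; the remaining lengths may sum to less
   than [2 * h ^ 2]. *)
- pose i := (d + 3) %/ 4.
  have -> : q = (q - 4 * i) + (4 * i + 0) by rewrite /i /d in d4 *; lia.
  by apply: theta_detour; [| | |apply: IH]; rewrite /i /d in d4 *; lia.
have -> : q = (q - d) + (4 * h + (d - 4 * h)) by rewrite /d in d4 *; lia.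
by apply: theta_detour; [| | |apply: IH]; rewrite /d in dh d4 *; lia.
Qed.

(** * From walks to embeddings *)

Lemma imset_pair (T U : finType) (f : T -> U) x y :
  f @: [set x; y] = [set f x; f y].
Proof. by rewrite imsetU1 imset_set1. Qed.

Lemma eq_set2 (T : finType) (a b c d : T) :
  [set a; b] = [set c; d] -> (a = c /\ b = d) \/ (a = d /\ b = c).
Proof.
move=> E; have /set2P A : a \in [set c; d] by rewrite -E set21.
have /set2P B : b \in [set c; d] by rewrite -E set22.
have /set2P C : c \in [set a; b] by rewrite E set21.
have /set2P D : d \in [set a; b] by rewrite E set22.
by intuition congruence.
Qed.

Lemma theta_embeddable k n j : j < n -> theta k j (n - j) ->
  embeddable (@chorded_cycle n j) (@complete_looped k).
Proof.
move=> jn [a [s [t [sj tn wk cl un]]]].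
have n0 : 0 < n by apply: leq_trans jn.
have st : size (s ++ t) = n by rewrite size_cat sj tn subnKC // ltnW.
pose w := a :: s ++ t; have k0 : 0 < k by case/andP: wk; case: (k).
have wlt i : nth 0 w i < k.
  have [iw|iw] := ltnP i (size w); last by rewrite nth_default.
  by apply: (allP wk); apply: mem_nth.
pose f (i : 'I_n) := Ordinal (wlt i).
have wn : nth 0 w n = a by rewrite -st -last_nth.
have fS i : val (f (ordS i)) = nth 0 w i.+1.
  rewrite [LHS]/=; have := ltn_ord i; rewrite leq_eqVlt => /predU1P[e|lt].
    by rewrite e modnn wn.
  by rewrite modn_small.
(* [None] stands for the chord and [Some i] for the cycle edge leaving [i]; [rank] is the position
   of its image in the repetition-free list [L]. *)
pose ends (o : option 'I_n) :=
  if o is Some i then (i, ordS i) else (Ordinal n0, Ordinal jn).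
pose L := edge a (last a s) :: pairmap edge a (s ++ t).
pose rank (o : option 'I_n) := if o is Some i then i.+1 else 0.
have nthL o : nth (0, 0) L (rank o) = edge (f (ends o).1) (f (ends o).2).
  case: o => [i|] /=.
    rewrite (nth_pairmap 0) ?st //; congr edge; exact/esym/fS.
  by congr edge; rewrite -[in RHS]sj -[w]cat_cons nth_cat /= ltnSn -last_nth.
have rankL o : rank o < size L.
  by rewrite /= size_pairmap st; case: o => //= i; rewrite ltnS.
have rankI o o' : rank o = rank o' -> o = o'.
  by case: o o' => [i|] [i'|] //= [] /val_inj ->.
have edgeE A : A \in edges (@chorded_cycle n j) ->
    exists o, A = [set (ends o).1; (ends o).2].
  rewrite inE => /existsP[u /existsP[v /andP[adj /eqP ->]]].
  case/orP: adj => /orP[].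
  - move/eqP=> uv; exists (Some u); congr [set _; _]; exact: val_inj.
  - move/eqP=> vu; exists (Some v); rewrite setUC; congr [set _; _]; exact: val_inj.
  - case/andP=> /eqP u0 /eqP vj; exists None.
    by congr [set _; _]; apply: val_inj.
  case/andP=> /eqP v0 /eqP uj; exists None.
  by rewrite setUC; congr [set _; _]; apply: val_inj.
exists f; split=> // A B /edgeE[o ->] /edgeE[o' ->] /=; rewrite !imset_pair => E.
suff /rankI -> : rank o = rank o' by [].
apply/eqP; rewrite -(nth_uniq (0, 0) (rankL o) (rankL o') un) !nthL.
by case/eq_set2: E => -[-> ->] //; rewrite edgeC.
Qed.

(** * Necessity: counting visits *)

Section Necessity.

Variables (k n j : nat) (f : 'I_n -> 'I_k).
Hypothesis n_ge3 : 3 <= n.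
Hypothesis (f_emb : embedding (@chorded_cycle n j) (@complete_looped k) f).

Let inj_f u v u' v' : chorded_cycle j u v -> chorded_cycle j u' v' ->
  [set f u; f v] = [set f u'; f v'] -> [set u; v] = [set u'; v'].
Proof.
move=> uv uv' E; apply: f_emb.2; last by rewrite /= !imset_pair.
  by rewrite inE; apply/existsP; exists u; apply/existsP; exists v; rewrite uv /=.
by rewrite inE; apply/existsP; exists u'; apply/existsP; exists v'; rewrite uv' /=.
Qed.

Lemma chorded_cycle_ordS (i : 'I_n) : chorded_cycle j i (ordS i).
Proof. by rewrite /chorded_cycle /cycle_adj eqxx. Qed.

Lemma ordS_ordS_neq (i : 'I_n) : ordS (ordS i) != i.
Proof.
rewrite -val_eqE /=; case: i => i /=.
rewrite leq_eqVlt => /predU1P[e|lt].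
  by rewrite e modnn modn_small; lia.
rewrite (modn_small lt); move: lt; rewrite leq_eqVlt => /predU1P[e|lt].
  by rewrite e modnn; lia.
by rewrite modn_small //; lia.
Qed.

(** Traversing one edge in opposite directions would force a cycle of length 2. *)
Lemma embedded_step_inj (i i' : 'I_n) :
  [set f i; f (ordS i)] = [set f i'; f (ordS i')] -> i = i'.
Proof.
move/(inj_f (chorded_cycle_ordS i) (chorded_cycle_ordS i')).
case/eq_set2=> [[]//|[e1 e2]].
by have := ordS_ordS_neq i'; rewrite -e1 e2 eqxx.
Qed.

Let steps v u := [set i | (f i == v) && (f (ordS i) == u)].

(** If [u != v], both directions use the same edge. If [u = v], the loop is counted in both
    terms. *)
Lemma card_steps v u : #|steps v u| + #|steps u v| <= 1 + (u == v).
Proof.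
have H (A : {set 'I_n}) :
    (forall i, i \in A -> [set f i; f (ordS i)] = [set u; v]) -> #|A| <= 1.
  move=> HA; apply/card_le1_eqP=> x y xA yA.
  by apply: embedded_step_inj; rewrite !HA.
have K w z i : i \in steps w z -> f i = w /\ f (ordS i) = z.
  by rewrite inE => /andP[/eqP -> /eqP ->].
have [?|ne] := eqVneq u v.
  subst u; by apply: leq_add; apply: H => i /K[-> ->].
have /eqP I0 : steps v u :&: steps u v == set0.
  rewrite -subset0; apply/subsetP=> i /setIP[/K[e _] /K[e' _]].
  by move: ne; rewrite -e e' eqxx.
rewrite addn0 -cardsUI I0 cards0 addn0.
by rewrite H // => i /setUP[]/K[-> ->] //; rewrite setUC.
Qed.

(* Each visit to [v] uses two edge-ends at [v], of which there are [k + 1]. *)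
Lemma card_visits v : ~~ odd k -> 2 * #|[set i | f i == v]| <= k.
Proof.
move=> k_even; have out : #|[set i | f i == v]| = \sum_u #|steps v u|.
  rewrite -sum1_card (partition_big (fun i => f (ordS i)) predT) //=.
  apply: eq_bigr => u _; rewrite -sum1_card; apply: eq_bigl => i.
  by rewrite !inE.
have into : #|[set i | f i == v]| = \sum_u #|steps u v|.
  (* Arrivals at [v] are indexed by the preceding position. *)
  rewrite -(card_imset _ (@ord_pred_inj n)) -sum1_card.
  rewrite (partition_big f predT) //=.
  apply: eq_bigr => u _; rewrite -sum1_card; apply: eq_bigl => i.
  rewrite -{1}(ordSK i) mem_imset; last exact: ord_pred_inj.
  by rewrite !inE andbC.
have : 2 * #|[set i | f i == v]| <= k.+1.
  rewrite mul2n -addnn {1}out into -big_split /=.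
  apply: (@leq_trans (\sum_(u : 'I_k) (1 + (u == v)))).
    by apply: leq_sum => u _; apply: card_steps.
  rewrite big_split /= sum1_card card_ord -addn1 leq_add2l.
  by rewrite (bigD1 v) //= eqxx big1 // => u /negbTE ->.
(* The left side is even and [k.+1] is odd. *)
by lia.
Qed.

Lemma order_eq_sum_visits : n = \sum_v #|[set i | f i == v]|.
Proof.
rewrite -[LHS](card_ord n) -sum1_card (partition_big f predT) //=.
by apply: eq_bigr => v _; rewrite -sum1_card; apply: eq_bigl => i; rewrite !inE.
Qed.

Lemma embeddable_order : ~~ odd k -> 2 * n <= k ^ 2.
Proof.
move=> k_even; rewrite {1}order_eq_sum_visits big_distrr /=.
apply: (@leq_trans (\sum_(v : 'I_k) k)).
  by apply: leq_sum => v _; apply: card_visits.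
by rewrite sum_nat_const card_ord.
Qed.

End Necessity.

(** * The exceptional triple (4, 8, 2) *)

(* Otherwise every vertex is visited exactly twice. The middle vertex [m] of the
   path of length 2 is visited a second time, and the two edges of that visit
   both avoid the ends of the path and [m] itself, so they coincide. *)
Lemma not_embeddable_482 :
  ~ embeddable (@chorded_cycle 8 2) (@complete_looped 4).
Proof.
move=> [f femb]; have stepI := embedded_step_inj (isT : 2 < 8) femb.
pose o (i : nat) : 'I_8 := inord i.
have So i : i < 7 -> ordS (o i) = o i.+1.
  by move=> i7; apply: val_inj; rewrite /= !inordK ?modn_small //; lia.
have oE i i' : i < 8 -> i' < 8 -> (o i == o i') = (i == i').
  by move=> ? ?; rewrite -val_eqE /= !inordK.
(* Each of the 4 vertices has at most 2 visits and there are 8 in all, so equality holds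
   throughout. *)
have c2 v : #|[set i | f i == v]| == 2.
  have := leqif_sum (fun (v : 'I_4) (_ : true) => leqif_eq
    (_ : #|[set i | f i == v]| <= 2)).
  case=> [w|_]; first by rewrite -(@leq_pmul2l 2) //; apply: (card_visits (isT : 2 < 8) femb).
  rewrite -order_eq_sum_visits sum_nat_const card_ord /= => /esym/forallP/(_ v).
  by [].
have chordI i : [set f (o 0); f (o 2)] <> [set f i; f (ordS i)].
  move=> E; have : [set o 0; o 2] = [set i; ordS i].
    apply: femb.2; rewrite /= ?imset_pair // inE.
      apply/existsP; exists (o 0); apply/existsP; exists (o 2).
      by rewrite eqxx andbT /chorded_cycle /chord_adj /= !inordK // orbT.
    apply/existsP; exists i; apply/existsP; exists (ordS i).
    by rewrite eqxx andbT chorded_cycle_ordS.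
  case/eq_set2=> -[e1 e2].
    by move/eqP: e2; rewrite -e1 So // oE.
  by move/eqP: e1; rewrite -e2 So // oE.
set a := f (o 0); set m := f (o 1); set b := f (o 2).
have am : a != m.
  apply/eqP=> e; apply: (chordI (o 1)); rewrite So // -/a -/m -/b e //.
have bm : b != m.
  apply/eqP=> e; apply: (chordI (o 0)); rewrite So // -/a -/m -/b e //.
have ab : a != b.
  apply/eqP=> e; have /stepI/eqP :
      [set f (o 0); f (ordS (o 0))] = [set f (o 1); f (ordS (o 1))].
    by rewrite !So // -/a -/m -/b e setUC.
  by rewrite oE.
have /cards2P[x [y [xy V]]] := c2 m.
have mV i : (f i == m) = (i \in [set x; y]) by rewrite -V inE.
wlog x1 : x y xy {V} mV / x = o 1.
  move=> W; have : o 1 \in [set x; y] by rewrite -mV.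
  case/set2P=> e; first exact: (W x y).
  by apply: (W y x) => //; [rewrite eq_sym | move=> i; rewrite setUC mV].
have fy : f y = m by apply/eqP; rewrite mV set22.
pose z := ord_pred y; have zy : ordS z = y by rewrite ord_predK.
have y0 : y != o 0 by apply: contra_neq am => e; rewrite /a -e.
have y1 : y != o 1 by rewrite -x1 eq_sym.
have y2 : y != o 2 by apply: contra_neq bm => e; rewrite /b -e.
have z0 : z != o 0 by apply: contra_neq y1; rewrite -zy => ->; rewrite So.
have z1 : z != o 1 by apply: contra_neq y2; rewrite -zy => ->; rewrite So.
have zny : z != y.
  by apply: contra_neq (ordS_ordS_neq (isT : 2 < 8) z) => e; rewrite zy -e zy.
(* Otherwise the step from [z] to [y] repeats one of the edges [a m], [m b], or [m] is visited a
   third time. *)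
have fz : f z \notin [:: a; m; b].
  rewrite !inE !negb_or; apply/and3P; split.
  - apply: contra_neq z0 => e; apply: stepI.
    by rewrite zy fy e So.
  - by rewrite mV !inE x1 negb_or z1.
  - apply: contra_neq z1 => e; apply: stepI.
    by rewrite zy fy e So // setUC.
have fSy : f (ordS y) \notin [:: f z; a; m; b].
  rewrite !inE !negb_or; apply/and4P; split.
  - apply: contra_neq zny => e; apply: stepI.
    by rewrite zy fy e setUC.
  - apply: contra_neq y0 => e; apply: stepI.
    by rewrite fy e So // setUC.
  - rewrite mV !inE x1 negb_or; apply/andP; split.
      by apply: contra_neq y0 => e; apply: (@ordS_inj 8); rewrite e So.
    by apply: contra_neq zny => e; apply: (@ordS_inj 8); rewrite zy.
  - apply: contra_neq y1 => e; apply: stepI.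
    by rewrite fy e So.
(* Five distinct vertices in a graph on four. *)
have U : uniq [:: f (ordS y); f z; a; m; b].
  by rewrite cons_uniq fSy cons_uniq fz /= !inE (eq_sym m) bm negb_or am ab.
by have := max_card (mem [:: f (ordS y); f z; a; m; b]); rewrite (card_uniqP U) card_ord.
Qed.

Theorem theorem3p2 (k n j : nat)
    (k_gt0 : 0 < k) (k_even : ~~ odd k)
    (j_ge2 : 2 <= j) (j_le : 2 * j <= n) :
  embeddable (@chorded_cycle n j) (@complete_looped k) <->
  [/\ 4 <= k, 2 * n <= k ^ 2 & (k, n, j) <> (4, 8, 2)].
Proof.
split=> [emb|[k4 nk ne]].
  have nk : 2 * n <= k ^ 2.
    by case: emb => f femb; apply: embeddable_order femb k_even; lia.
  (* Here [n >= 4] gives [k ^ 2 >= 8], so [k >= 3], and [k] is even. *)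
  split=> //; first by move: nk; rewrite !expnS expn0; nia.
  by case=> ek en ej; move: emb; rewrite ek en ej; apply: not_embeddable_482.
apply: theta_embeddable; first by lia.
have ek : k = k./2.*2 by lia.
move: k4 nk ne; rewrite {}ek; set h := k./2 => k4 nk ne.
have [h2|h3] := leqP h 2; last by apply: theta_even => //; [lia | nia].
have {h2} ek : h = 2 by lia.
rewrite ek in nk ne *; apply: theta4; [lia | by move: nk; rewrite /=; lia |].
by apply/eqP=> -[ej en]; apply: ne; rewrite ej; congr (_, _, _); lia.
Qed.
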